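(* Let $K$ be a commutative unital ring, $G$ a group, $\pi: G\to\operatorname{End}_K(M)$ a partial representation of $G$ on a $K$-module $M$, and let $\alpha$ be the partial action of $G$ on $M$ induced by $\pi$. Then the global action $\Theta$ of $G$ on $KG\otimes_{G_{par}} M$, $\Theta_h(g\otimes_{G_{par}}m)=hg\otimes_{G_{par}}m$, with the map $\iota:M\to KG\otimes_{G_{par}}M$, $\iota(m)=1\otimes_{G_{par}}m$, is the universal globalization of $\alpha$.
   Context: $K$ is a fixed commutative unital ring; $\otimes=\otimes_K$; $G$ is a group. A partial representation of $G$ on a $K$-module $M$ is a map $\pi:G\to\operatorname{End}_K(M)$, $g\mapsto\pi_g$, with $\pi_1=\mathrm{id}$, $\pi_s\pi_t\pi_{t^{-1}}=\pi_{st}\pi_{t^{-1}}$ and $\pi_{s^{-1}}\pi_s\pi_t=\pi_{s^{-1}}\pi_{st}$ for all $s,t\in G$. A (left) partial action $\alpha=(G,M,\{M_g\},\{\alpha_g\})$ of $G$ on a $K$-module $M$ consists of $K$-submodules $M_g\subseteq M$ and $K$-linear isomorphisms $\alpha_g:M_{g^{-1}}\to M_g$ such that (i) $M_1=M$, $\alpha_1=\mathrm{id}_M$; (ii) $\alpha_g(M_{g^{-1}}\cap M_{g^{-1}h})\subseteq M_g\cap M_h$; (iii) $\alpha_g\alpha_h(x)=\alpha_{gh}(x)$ for $x\in M_{h^{-1}}\cap M_{h^{-1}g^{-1}}$. It is global if $M_g=M$ for all $g$. A $G$-equivariant map $\phi:M\to N$ between modules with partial actions $\alpha,\beta$ is a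 $K$-linear map with $\phi(M_g)\subseteq N_g$ and $\phi(\alpha_g(x))=\beta_g(\phi(x))$ for $x\in M_{g^{-1}}$. The partial action induced by $\pi$ is given by $M_g:=\pi_g\pi_{g^{-1}}(M)$ and $\alpha_g:=\pi_g|_{M_{g^{-1}}}$. $KG\otimes_{G_{par}}M$ is the quotient of $KG\otimes M$ by the $K$-submodule generated by all $gh\otimes m-g\otimes\alpha_h(m)$ with $g,h\in G$, $m\in M_{h^{-1}}$. For every partial action $\alpha$, the pair $(\Theta,\iota)$ is the universal global action of $\alpha$: $\iota$ is $G$-equivariant and every $G$-equivariant map from $M$ to a $G$-module factors uniquely through $\iota$ via a morphism of $G$-modules. A global action $\theta$ of $G$ on $W$ together with an injective $G$-equivariant map $j:M\to W$ is a globalization of $\alpha$ if $W=\sum_{g\in G}\theta_g(j(M))$ and $\alpha$ is isomorphic via $j$ to the restriction of $\theta$ to $j(M)$, i.e. $j(M_g)=\theta_g(j(M))\cap j(M)$ for all $g\in G$. When the universal global action $(\Theta,\iota)$ of $\alpha$ is a globalization of $\alpha$, it is called the universal globalization of $\alpha$. *)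

(* Defs.v *)
From HB Require Import structures.
From mathcomp Require Import all_boot all_order all_algebra.
From mathcomp Require Import finmap generic_quotient ring_quotient.
From mathcomp Require Import boolp classical_sets functions.
From mathcomp.multinomials Require Import monalg.

Set Implicit Arguments.
Unset Strict Implicit.
Unset Printing Implicit Defensive.

Import GRing.Theory.
Local Open Scope quotient_scope.
Local Open Scope classical_set_scope.
Local Open Scope ring_scope.

Section Span.
Context {K : pzRingType} {V : lmodType K}.

Definition submodule (A : set V) : Prop := submod_closed [in A].

Definition span (S : set V) : set V := smallest submodule S.

Lemma submoduleP (A : set V) :
  submodule A <-> A 0 /\ (forall a u v, A u -> A v -> A (a *: u + v)).
Proof.
split=> [[A0 AL]|[A0 AL]]; split=> [|a u v].
- by move: A0; rewrite !inE.
- by move=> Au Av; have := AL a u v; rewrite !inE; apply.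
- by rewrite !inE.
- by rewrite !inE; apply: AL.
Qed.

Lemma span_submodule (S : set V) : submodule (span S).
Proof.
apply/submoduleP; split=> [A [/submoduleP[A0 _] _]|a u v Su Sv A [mA SA]] //.
by case/submoduleP: (mA) => _; apply; [apply: Su | apply: Sv].
Qed.

Lemma span_sub (S : set V) v : S v -> span S v.
Proof. by move=> Sv A [_]; apply. Qed.

Definition span_pred (S : set V) : pred V := fun v => v \in span S.

Fact span_pred_closed (S : set V) : submod_closed (span_pred S).
Proof. exact: span_submodule. Qed.

HB.instance Definition _ S := GRing.isZmodClosed.Build V (span_pred S)
  (GRing.submod_closedB (span_pred_closed S)).

Definition span_zmod (S : set V) : zmodClosed V :=
  GRing.ZmodClosed.clone V (span_pred S) _.

Definition quotmod (S : set V) : Type := Quotient.quot (span_zmod S).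

HB.instance Definition _ S := GRing.Zmodule.on (quotmod S).

Definition quot_pi (S : set V) (v : V) : quotmod S :=
  \pi_(Quotient.quot (span_zmod S)) v.

Lemma quot_piP S u v : quot_pi S u = quot_pi S v <-> span S (u - v).
Proof.
rewrite /quot_pi; split=> [/eqP|uv].
  by rewrite -Quotient.idealrBE /= => /set_mem.
by apply/eqP; rewrite -Quotient.idealrBE; apply/mem_set.
Qed.

Definition quot_repr S (x : quotmod S) : V := repr x.

Lemma quot_reprK S : cancel (@quot_repr S) (quot_pi S).
Proof. by move=> x; rewrite /quot_pi /quot_repr; exact: reprK. Qed.

Lemma quot_piB S : zmod_morphism (quot_pi S).
Proof. exact: (raddfB (\pi_(Quotient.quot (span_zmod S)))). Qed.

HB.instance Definition _ S :=
  GRing.isZmodMorphism.Build V (quotmod S) (quot_pi S) (@quot_piB S).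

Definition quot_scale S (a : K) (x : quotmod S) : quotmod S :=
  quot_pi S (a *: quot_repr x).

Lemma quot_scale_pi S a v : quot_scale a (quot_pi S v) = quot_pi S (a *: v).
Proof.
apply/quot_piP; rewrite -scalerBr.
have /submoduleP[S0 SL] := span_submodule S.
by rewrite -[_ *: _]addr0; apply: SL => //; apply/quot_piP; rewrite quot_reprK.
Qed.

Fact quot_scaleA S a b x :
  @quot_scale S a (quot_scale b x) = quot_scale (a * b) x.
Proof. by rewrite -[x]quot_reprK !quot_scale_pi scalerA. Qed.

Fact quot_scale1 S : left_id 1 (@quot_scale S).
Proof. by move=> x; rewrite -[x]quot_reprK quot_scale_pi scale1r. Qed.

Fact quot_scaleDr S : right_distributive (@quot_scale S) +%R.
Proof.
move=> a x y; rewrite -[x]quot_reprK -[y]quot_reprK.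
by rewrite -raddfD !quot_scale_pi -raddfD scalerDr.
Qed.

Fact quot_scaleDl S x : {morph (@quot_scale S)^~ x : a b / a + b}.
Proof.
move=> a b; rewrite -[x]quot_reprK.
by rewrite !quot_scale_pi -raddfD scalerDl.
Qed.

HB.instance Definition _ S := GRing.Zmodule_isLmodule.Build K (quotmod S)
  (@quot_scaleA S) (@quot_scale1 S) (@quot_scaleDr S) (@quot_scaleDl S).

Lemma quot_piZ S : scalable (quot_pi S).
Proof. by move=> a v; rewrite -quot_scale_pi. Qed.

HB.instance Definition _ S :=
  GRing.isScalable.Build K V (quotmod S) *:%R (quot_pi S) (@quot_piZ S).

End Span.

Section QuotLift.
Context {K : pzRingType} {V N : lmodType K} (S : set V) (f : {linear V -> N}).
Hypothesis fS : forall v, S v -> f v = 0.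

Lemma span_ker v : span S v -> f v = 0.
Proof.
move=> Sv; apply: (Sv [set u | f u = 0]); split=> //.
apply/submoduleP; split=> [|a u w /= fu fw]; first exact: linear0.
by rewrite linearP fu fw scaler0 addr0.
Qed.

Definition quot_lift_fun (x : quotmod S) : N := f (quot_repr x).

Fact quot_lift_fun_pi v : quot_lift_fun (quot_pi S v) = f v.
Proof.
apply/eqP; rewrite /quot_lift_fun -subr_eq0 -linearB; apply/eqP/span_ker.
by apply/quot_piP; rewrite quot_reprK.
Qed.

Fact quot_lift_linear : linear quot_lift_fun.
Proof.
move=> a x y; rewrite -[x]quot_reprK -[y]quot_reprK -linearP.
by rewrite !quot_lift_fun_pi linearP.
Qed.

Definition quot_lift : {linear quotmod S -> N} := HB.pack quot_lift_fun
  (GRing.isLinear.Build K (quotmod S) N *:%R quot_lift_fun quot_lift_linear).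

Lemma quot_lift_pi v : quot_lift (quot_pi S v) = f v.
Proof. exact: quot_lift_fun_pi. Qed.

End QuotLift.

(* [monalg] makes [{malg K[X]}] a K-module only for a nontrivial ring K (and a
   ring only over monoids without nontrivial units, which excludes groups);
   the alias carries the K-module structure over an arbitrary K. *)
Section FreeModule.
Context (K : pzRingType) (X : choiceType).

Definition freemod : Type := {malg K[X]}.

HB.instance Definition _ := GRing.Zmodule.on freemod.

Definition free_scale (a : K) (u : freemod) : freemod :=
  [malg x in msupp u => a * u@_x].

Lemma free_scaleE a u x : (free_scale a u)@_x = a * u@_x.
Proof. by rewrite mcoeffE; case: msuppP; rewrite ?mulr0. Qed.

Fact free_scaleA a b u : free_scale a (free_scale b u) = free_scale (a * b) u.
Proof. by apply/malgP=> x; rewrite !free_scaleE mulrA. Qed.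

Fact free_scale1 : left_id 1 free_scale.
Proof. by move=> u; apply/malgP=> x; rewrite free_scaleE mul1r. Qed.

Fact free_scaleDr : right_distributive free_scale +%R.
Proof.
by move=> a u v; apply/malgP=> x; rewrite mcoeffD !free_scaleE mcoeffD mulrDr.
Qed.

Fact free_scaleDl u : {morph free_scale^~ u : a b / a + b}.
Proof.
by move=> a b; apply/malgP=> x; rewrite mcoeffD !free_scaleE mulrDl.
Qed.

HB.instance Definition _ := GRing.Zmodule_isLmodule.Build K freemod
  free_scaleA free_scale1 free_scaleDr free_scaleDl.

Definition free_gen (x : X) : freemod := mkmalgU x 1.

Lemma free_mcoeffZ a (u : freemod) x : (a *: u)@_x = a * u@_x.
Proof. exact: free_scaleE. Qed.

Lemma free_genE (u : freemod) : u = \sum_(x <- msupp u) u@_x *: free_gen x.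
Proof.
rewrite {1}[u]monalgE; apply: eq_bigr => x _; apply/malgP=> y.
by rewrite free_mcoeffZ !mcoeffU mulrnAr mulr1.
Qed.

Lemma free_ind (P : freemod -> Prop) : P 0 ->
  (forall a x u, P u -> P (a *: free_gen x + u)) -> forall u, P u.
Proof.
move=> P0 PD u; rewrite [u]free_genE; elim/big_rec: _ => // x v _.
exact: PD.
Qed.

End FreeModule.

Arguments free_gen {K X} x.

Section FreeLift.
Context {K : pzRingType} {X : choiceType} {N : lmodType K} (f : X -> N).

Definition free_lift (u : freemod K X) : N := \sum_(x <- msupp u) u@_x *: f x.

Lemma free_liftw (u : freemod K X) (d : seq X) : uniq d ->
  {subset (msupp u : seq X) <= d} -> free_lift u = \sum_(x <- d) u@_x *: f x.
Proof.
move=> Ud sud; rewrite (bigID (fun x => x \in msupp u)) /=.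
rewrite [X in _ + X]big1 ?addr0 => [|x /mcoeff_outdom ->]; last first.
  by rewrite scale0r.
rewrite -[RHS]big_filter; apply: perm_big; apply: uniq_perm => //.
  exact: filter_uniq.
by move=> x; rewrite mem_filter; case: (boolP (x \in _)) => // /sud.
Qed.

Lemma free_lift_linear : linear free_lift.
Proof.
move=> a u v; pose s := undup ((msupp u : seq X) ++ (msupp v : seq X)
   ++ (msupp (a *: u + v) : seq X)).
rewrite !(@free_liftw _ s) ?undup_uniq //.
- rewrite scaler_sumr -big_split /=; apply: eq_bigr => x _.
  by rewrite mcoeffD free_mcoeffZ scalerDl scalerA.
- by move=> x xs; rewrite mem_undup !mem_cat; apply/or3P; apply: Or32.
- by move=> x xs; rewrite mem_undup !mem_cat; apply/or3P; apply: Or31.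
- by move=> x xs; rewrite mem_undup !mem_cat; apply/or3P; apply: Or33.
Qed.

HB.instance Definition _ :=
  GRing.isLinear.Build K (freemod K X) N *:%R free_lift free_lift_linear.

Lemma free_lift_gen x : free_lift (free_gen x) = f x.
Proof.
rewrite (@free_liftw _ [:: x]) ?big_seq1 ?mcoeffUU ?scale1r //.
by move=> y /(fsubsetP msuppU_le); rewrite finmap.inE mem_seq1.
Qed.

End FreeLift.

Section Tensor.
Context {K : comPzRingType}.

Section Def.
Context (A B : lmodType K).

Definition tensor_rel : set (freemod K (A * B)%type) :=
  [set t | (exists a x x' y, t = free_gen (a *: x + x', y)
              - (a *: free_gen (x, y) + free_gen (x', y)))
        \/ (exists a x y y', t = free_gen (x, a *: y + y')
              - (a *: free_gen (x, y) + free_gen (x, y')))].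

Definition tensor : lmodType K := quotmod tensor_rel.

Definition tens (x : A) (y : B) : tensor :=
  quot_pi tensor_rel (free_gen (x, y)).

Lemma tens_linearl y : linear (tens^~ y).
Proof.
move=> a x x'; rewrite /tens -linearP; apply/quot_piP; apply: span_sub; left.
by exists a, x, x', y.
Qed.

Lemma tens_linearr x : linear (tens x).
Proof.
move=> a y y'; rewrite /tens -linearP; apply/quot_piP; apply: span_sub; right.
by exists a, x, y, y'.
Qed.

HB.instance Definition _ x :=
  GRing.isLinear.Build K B tensor *:%R (tens x) (tens_linearr x).

Lemma tensor_ind (P : tensor -> Prop) : P 0 ->
  (forall a x y t, P t -> P (a *: tens x y + t)) -> forall t, P t.
Proof.
move=> P0 PD t; rewrite -[t]quot_reprK; elim/free_ind: (quot_repr t).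
  by rewrite linear0.
by move=> a [x y] u Pu; rewrite linearP; apply: PD.
Qed.

End Def.

Section Lift.
Context {A B N : lmodType K} (f : A -> B -> N).
Hypotheses (fl : forall y, linear (f^~ y)) (fr : forall x, linear (f x)).

Definition tensor_lift0 : freemod K (A * B)%type -> N :=
  free_lift (fun p => f p.1 p.2).

HB.instance Definition _ := GRing.Linear.on tensor_lift0.

Lemma tensor_lift_subproof t : tensor_rel t -> tensor_lift0 t = 0.
Proof.
rewrite /tensor_lift0; case=> [[a [x [x' [y ->]]]]|[a [x [y [y' ->]]]]].
  by rewrite linearB linearP /= !free_lift_gen /= fl subrr.
by rewrite linearB linearP /= !free_lift_gen /= fr subrr.
Qed.

Definition tensor_lift : {linear tensor A B -> N} :=
  quot_lift tensor_lift_subproof.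

Lemma tensor_lift_tens x y : tensor_lift (tens x y) = f x y.
Proof.
by rewrite /tensor_lift quot_lift_pi /= /tensor_lift0 free_lift_gen.
Qed.

End Lift.

End Tensor.

(* [pact g] is a total function standing for an isomorphism from [pdom g^-1]
   to [pdom g]; its values outside [pdom g^-1] are junk and are never used. *)
Record partial_action {K : pzRingType} (G : groupType) (M : lmodType K) :=
  PartialAction {
  pdom : G -> set M;
  pact : G -> M -> M;
  pdom_submodule : forall g, submodule (pdom g);
  pact_linear : forall g a x y, pdom g^-1%g x -> pdom g^-1%g y ->
    pact g (a *: x + y) = a *: pact g x + pact g y;
  pact_bij : forall g, set_bij (pdom g^-1%g) (pdom g) (pact g);
  pdom1 : pdom 1%g = setT;
  pact1 : forall x, pact 1%g x = x;
  pact_cap : forall g h,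
    pact g @` (pdom g^-1%g `&` pdom (g^-1 * h)%g) `<=` pdom g `&` pdom h;
  pactM : forall g h x, (pdom h^-1%g `&` pdom (h^-1 * g^-1)%g) x ->
    pact g (pact h x) = pact (g * h)%g x
}.

Record partial_rep {K : pzRingType} (G : groupType) (M : lmodType K) :=
  PartialRep {
  prep :> G -> {linear M -> M};
  prep1 : forall x, prep 1%g x = x;
  prepMVr : forall s t x,
    prep s (prep t (prep t^-1%g x)) = prep (s * t)%g (prep t^-1%g x);
  prepMVl : forall s t x,
    prep s^-1%g (prep s (prep t x)) = prep s^-1%g (prep (s * t)%g x)
}.

Section InducedAction.
Context {K : pzRingType} {G : groupType} {M : lmodType K}.
Variable pi : partial_rep G M.

Definition induced_dom (g : G) : set M := range (fun x => pi g (pi g^-1%g x)).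

Lemma prepVK g x : pi g (pi g^-1%g (pi g x)) = pi g x.
Proof.
by have := prepMVr pi g g^-1%g x; rewrite invgK mulgV prep1.
Qed.

Lemma induced_domP g x : induced_dom g x <-> pi g (pi g^-1%g x) = x.
Proof.
split=> [[y _ <-]|<-]; last by exists x.
by rewrite prepVK.
Qed.

Lemma induced_domV g x : induced_dom g^-1%g x <-> pi g^-1%g (pi g x) = x.
Proof. by rewrite induced_domP invgK. Qed.

Lemma prep_dom g x : induced_dom g (pi g x).
Proof. by apply/induced_domP; rewrite prepVK. Qed.

Lemma prep_e g h x :
  pi g (pi h (pi h^-1%g x)) =
  pi (g * h)%g (pi (g * h)^-1%g (pi g x)).
Proof.
rewrite prepMVr; have := prepMVl pi (g * h)^-1%g g x.
by rewrite invgK => ->; rewrite invgM -mulgA mulVg mulg1.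
Qed.

Fact induced_submodule g : submodule (induced_dom g).
Proof.
apply/submoduleP; split=> [|a u v].
  by apply/induced_domP; rewrite !linear0.
move=> /induced_domP gu /induced_domP gv.
by apply/induced_domP; rewrite !linearP gu gv.
Qed.

Fact induced_linear g a x y : induced_dom g^-1%g x -> induced_dom g^-1%g y ->
  pi g (a *: x + y) = a *: pi g x + pi g y.
Proof. by rewrite linearP. Qed.

Fact induced_bij g : set_bij (induced_dom g^-1%g) (induced_dom g) (pi g).
Proof.
split=> [x _|x y /set_mem/induced_domV gx /set_mem/induced_domV gy e|x].
- exact: prep_dom.
- by rewrite -gx -gy e.
- by move=> /induced_domP gx; exists (pi g^-1%g x) => //; apply: prep_dom.
Qed.

Fact induced_dom1 : induced_dom 1%g = setT.
Proof.
by apply/seteqP; split=> // x _; apply/induced_domP; rewrite invg1 !prep1.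
Qed.

Fact induced_cap g h :
  pi g @` (induced_dom g^-1%g `&` induced_dom (g^-1 * h)%g) `<=`
  induced_dom g `&` induced_dom h.
Proof.
move=> _ [x [_ /induced_domP xh] <-]; split; first exact: prep_dom.
by apply/induced_domP; rewrite -{2}xh prep_e mulgA mulgV mul1g.
Qed.

Fact inducedM g h x :
  (induced_dom h^-1%g `&` induced_dom (h^-1 * g^-1)%g) x ->
  pi g (pi h x) = pi (g * h)%g x.
Proof.
move=> [/induced_domP hx _]; move: hx; rewrite invgK => hx.
by have := prepMVr pi g h (pi h x); rewrite hx.
Qed.

Definition induced_partial_action : partial_action G M :=
  @PartialAction K G M induced_dom (fun g => pi g)
    induced_submodule induced_linear induced_bij
    induced_dom1 (prep1 pi) induced_cap inducedM.

End InducedAction.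

Section Notions.
Context {K : pzRingType} {G : groupType}.

Definition is_global {M : lmodType K} (alpha : partial_action G M) : Prop :=
  forall g, pdom alpha g = setT.

Definition equivariant {M N : lmodType K} (alpha : partial_action G M)
    (beta : partial_action G N) (phi : {linear M -> N}) : Prop :=
  forall g, phi @` pdom alpha g `<=` pdom beta g /\
    (forall x, pdom alpha g^-1%g x -> phi (pact alpha g x) = pact beta g (phi x)).

Definition universal_global_action {M W : lmodType K}
    (alpha : partial_action G M) (theta : partial_action G W)
    (iota : {linear M -> W}) : Prop :=
  [/\ is_global theta, equivariant alpha theta iota &
    forall (N : lmodType K) (beta : partial_action G N) (phi : {linear M -> N}),
      is_global beta -> equivariant alpha beta phi ->
      exists psi : {linear W -> N},
        [/\ equivariant theta beta psi, (forall x, psi (iota x) = phi x) &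
          forall psi' : {linear W -> N}, equivariant theta beta psi' ->
            (forall x, psi' (iota x) = phi x) -> psi' =1 psi]].

(* The sum of a family of submodules is the span of their union. *)
Definition is_globalization {M W : lmodType K}
    (alpha : partial_action G M) (theta : partial_action G W)
    (j : {linear M -> W}) : Prop :=
  [/\ is_global theta, injective j /\ equivariant alpha theta j,
    span (\bigcup_g (pact theta g @` range j)) = setT &
    forall g, j @` pdom alpha g = (pact theta g @` range j) `&` range j].

Definition universal_globalization {M W : lmodType K}
    (alpha : partial_action G M) (theta : partial_action G W)
    (iota : {linear M -> W}) : Prop :=
  universal_global_action alpha theta iota /\ is_globalization alpha theta iota.

Section GlobalAction.
Context {W : lmodType K} (theta : G -> {linear W -> W}).
Hypothesis theta1 : forall x, theta 1%g x = x.
Hypothesis thetaM : forall g h x, theta (g * h)%g x = theta g (theta h x).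

Definition global_dom (_ : G) : set W := setT.

Fact global_submodule g : submodule (global_dom g).
Proof. exact/submoduleP. Qed.

Fact global_linear g a x y : global_dom g^-1%g x -> global_dom g^-1%g y ->
  theta g (a *: x + y) = a *: theta g x + theta g y.
Proof. by rewrite linearP. Qed.

Fact global_bij g : set_bij (global_dom g^-1%g) (global_dom g) (theta g).
Proof.
split=> // [x y _ _ e|x _].
  by rewrite -[x]theta1 -[y]theta1 -(mulVg g) !thetaM e.
by exists (theta g^-1%g x) => //; rewrite -thetaM mulgV theta1.
Qed.

Fact global_cap g h :
  theta g @` (global_dom g^-1%g `&` global_dom (g^-1 * h)%g) `<=`
  global_dom g `&` global_dom h.
Proof. by []. Qed.

Fact globalM g h x : (global_dom h^-1%g `&` global_dom (h^-1 * g^-1)%g) x ->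
  theta g (theta h x) = theta (g * h)%g x.
Proof. by rewrite thetaM. Qed.

Definition global_action : partial_action G W :=
  @PartialAction K G W global_dom (fun g => theta g) global_submodule
    global_linear global_bij erefl theta1 global_cap globalM.

End GlobalAction.

End Notions.

Section GparTensor.
Context {K : comPzRingType} {G : groupType} {M : lmodType K}.
Variable alpha : partial_action G M.

(* The relations and the action only involve products of basis elements, i.e.
   products in G, so only the K-module underlying the group algebra is built. *)
Definition KG : lmodType K := freemod K G.

Definition KG_lmul (h : G) : {linear KG -> KG} :=
  free_lift (fun g => free_gen (h * g)%g : KG).

Fact KG_lmul_gen h g : KG_lmul h (free_gen g) = free_gen (h * g)%g.
Proof. exact: free_lift_gen. Qed.

Definition gpar_rel : set (tensor KG M) :=
  [set t | exists g h m, pdom alpha h^-1%g m /\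
     t = tens (free_gen (g * h)%g : KG) m - tens (free_gen g : KG) (pact alpha h m)].

Definition gpar_tensor : lmodType K := quotmod gpar_rel.

Definition gpar (g : G) (m : M) : gpar_tensor :=
  quot_pi gpar_rel (tens (free_gen g : KG) m).

Lemma gpar_linear g : linear (gpar g).
Proof. by move=> a x y; rewrite /gpar !linearP. Qed.

Definition gpar_iota_fun (m : M) : gpar_tensor := gpar 1%g m.

HB.instance Definition _ :=
  GRing.isLinear.Build K M gpar_tensor *:%R gpar_iota_fun (gpar_linear 1%g).

Definition gpar_iota : {linear M -> gpar_tensor} := gpar_iota_fun.

Lemma gpar_ind (P : gpar_tensor -> Prop) : P 0 ->
  (forall a g m t, P t -> P (a *: gpar g m + t)) -> forall t, P t.
Proof.
move=> P0 PD t; rewrite -[t]quot_reprK; elim/(@tensor_ind K KG M): (quot_repr t).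
  by rewrite linear0.
move=> a x m u Pu; rewrite linearP /=.
suff: forall b t, P t -> P (b *: quot_pi gpar_rel (tens x m) + t) by apply.
elim/free_ind: x => [|c g x IHx] b v Pv.
  have -> : tens (0 : KG) m = 0.
    by have := tens_linearl m (-1) (0 : KG) 0; rewrite scaler0 addr0 scaleN1r addNr.
  by rewrite linear0 scaler0 add0r.
rewrite (tens_linearl m c (free_gen g : KG) x) linearP /= scalerDr scalerA -addrA.
by apply: PD; apply: IHx.
Qed.

Section Translation.
Variable h : G.

Let f (x : KG) (m : M) : gpar_tensor := quot_pi gpar_rel (tens (KG_lmul h x) m).

Fact gpar_lmul_linearl m : linear (f^~ m).
Proof. by move=> a x y; rewrite /f [KG_lmul _ _]linearP tens_linearl linearP. Qed.

Fact gpar_lmul_linearr x : linear (f x).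
Proof. by move=> a m m'; rewrite /f !linearP. Qed.

Definition gpar_lmul0 : {linear tensor KG M -> gpar_tensor} :=
  tensor_lift gpar_lmul_linearl gpar_lmul_linearr.

Fact gpar_lmul0E g m :
  gpar_lmul0 (tens (free_gen g : KG) m) = gpar (h * g)%g m.
Proof.
have -> : gpar (h * g)%g m = f (free_gen g) m by rewrite /f KG_lmul_gen.
exact: (tensor_lift_tens gpar_lmul_linearl gpar_lmul_linearr).
Qed.

Fact gpar_lmul_rel t : gpar_rel t -> gpar_lmul0 t = 0.
Proof.
case=> g [k [m [km ->]]].
rewrite (linearB gpar_lmul0) [X in X - _]gpar_lmul0E [X in _ - X]gpar_lmul0E.
rewrite mulgA; apply/eqP; rewrite subr_eq0; apply/eqP/quot_piP.
by apply: span_sub; exists (h * g)%g, k, m.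
Qed.

Definition gpar_lmul : {linear gpar_tensor -> gpar_tensor} :=
  quot_lift gpar_lmul_rel.

Lemma gpar_lmulE g m : gpar_lmul (gpar g m) = gpar (h * g)%g m.
Proof.
exact: etrans (quot_lift_pi gpar_lmul_rel _) (gpar_lmul0E _ _).
Qed.

End Translation.

Fact gpar_lmul1 t : gpar_lmul 1%g t = t.
Proof.
elim/gpar_ind: t => [|a g m t IH]; first by rewrite linear0.
by rewrite linearP gpar_lmulE mul1g IH.
Qed.

Fact gpar_lmulM g h t : gpar_lmul (g * h)%g t = gpar_lmul g (gpar_lmul h t).
Proof.
elim/gpar_ind: t => [|a k m t IH]; first by rewrite !linear0.
by rewrite !linearP !gpar_lmulE mulgA IH.
Qed.

Definition Theta : partial_action G gpar_tensor :=
  global_action gpar_lmul1 gpar_lmulM.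

End GparTensor.

Arguments KG : clear implicits.

(* Main.v *)
Require Import Defs.
From HB Require Import structures.
From mathcomp Require Import all_boot all_order all_algebra.
From mathcomp Require Import boolp classical_sets functions.

(** The only part of the theorem that is special to partial actions coming from
    a partial representation is that [iota] is an embedding whose image meets
    its translates no more than it has to.  For a general partial action this
    fails: the relations of the tensor product may identify elements of [M].

    Both universality and embedding rest on [gpar_lift]: a linear map out of
    the tensor product is a family of linear maps [F g] on [M] such that
    [F (g * h)] and [F g \o alpha h] agree on the domain of [alpha h].
    - A [G]-equivariant map [phi] to a [G]-module [beta] gives the family
      [beta g \o phi], hence the unique extension of [phi] along [iota].
    - The partial representation is such a family: on the domain of [pi h] one
      has [m = pi h^-1 (pi h m)], and [pi g * pi h * pi h^-1] equals
      [pi (g * h) * pi h^-1].  This yields the evaluation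
      [g (x) m |-> pi g m], a linear retraction of [iota] ([gpar_eval]).
    Because of the retraction [iota] is injective.  If [1 (x) m = g (x) m'],
    evaluating both sides gives [m = pi g m'], which lies in [M_g]; so the image
    of [M] meets its translate by [g] in [iota M_g] only. *)

Set Implicit Arguments.
Unset Strict Implicit.
Unset Printing Implicit Defensive.

Import GRing.Theory.
Local Open Scope classical_set_scope.
Local Open Scope ring_scope.

Section GparTensorTheory.
Context {K : comPzRingType} {G : groupType} {M : lmodType K}.
Variable alpha : partial_action G M.

Lemma gpar_act g h m : pdom alpha h^-1%g m ->
  gpar alpha (g * h)%g m = gpar alpha g (pact alpha h m).
Proof. by move=> hm; apply/quot_piP; apply: span_sub; exists g, h, m. Qed.

Lemma Theta_gpar h g m :
  pact (Theta alpha) h (gpar alpha g m) = gpar alpha (h * g)%g m.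
Proof. exact: gpar_lmulE. Qed.

Lemma Theta_linear g : linear (pact (Theta alpha) g).
Proof. exact: (linearP (gpar_lmul alpha g)). Qed.

Lemma gpar_iotaE m : gpar_iota alpha m = gpar alpha 1%g m.
Proof. by []. Qed.

Lemma Theta_iota g m : pact (Theta alpha) g (gpar_iota alpha m) = gpar alpha g m.
Proof. by rewrite gpar_iotaE Theta_gpar mulg1. Qed.

Lemma gpar_iota_equivariant : equivariant alpha (Theta alpha) (gpar_iota alpha).
Proof.
move=> g; split=> [//|m gm]; have e := gpar_act 1%g gm.
rewrite mul1g in e.
exact: esym (etrans (Theta_iota g m) e).
Qed.

Lemma gpar_ext {N : lmodType K} (f1 f2 : gpar_tensor alpha -> N) :
  linear f1 -> linear f2 -> (forall g m, f1 (gpar alpha g m) = f2 (gpar alpha g m)) ->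
  f1 =1 f2.
Proof.
have lin0 (f : gpar_tensor alpha -> N) : linear f -> f 0 = 0.
  by move=> fL; have := fL (-1) 0 0; rewrite !scaleN1r oppr0 addr0 addNr.
move=> f1L f2L f12; elim/(gpar_ind (alpha := alpha)) => [|a g m t IH].
  by rewrite !lin0.
by rewrite f1L f2L f12 IH.
Qed.

Lemma gpar_span :
  Defs.span (\bigcup_g (pact (Theta alpha) g @` range (gpar_iota alpha))) = setT.
Proof.
set S := \bigcup_g _; apply/seteqP; split=> // t _.
have /submoduleP[S0 SL] := span_submodule S.
elim/(gpar_ind (alpha := alpha)): t => // a g m t St; apply: SL => //; apply: span_sub.
exists g => //; exists (gpar_iota alpha m); first by exists m.
exact: Theta_iota.
Qed.

Section Lift.
Context {N : lmodType K} (F : G -> M -> N).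
Hypothesis F_linear : forall g, linear (F g).
Hypothesis F_act : forall g h m, pdom alpha h^-1%g m ->
  F (g * h)%g m = F g (pact alpha h m).

Let f (x : KG K G) (m : M) : N := free_lift (F^~ m) x.

Let f_linearl m : linear (f^~ m).
Proof. by move=> a x y; rewrite /f linearP. Qed.

Let f_linearr x : linear (f x).
Proof.
move=> a m m'; rewrite /f /free_lift scaler_sumr -big_split /=.
by apply: eq_bigr => g _; rewrite F_linear scalerDr !scalerA mulrC.
Qed.

Let f_gen g m :
  tensor_lift f_linearl f_linearr (tens (free_gen g : KG K G) m) = F g m.
Proof. by rewrite tensor_lift_tens /f free_lift_gen. Qed.

(** Prescribing [L] on the generators [g (x) m] of the quotient replaces the
    two-step lift through [KG (x) M]: [g |-> F g m] extends linearly to [KG],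
    and the result kills the relations exactly by [F_act]. *)
Lemma gpar_lift :
  exists L : {linear gpar_tensor alpha -> N}, forall g m, L (gpar alpha g m) = F g m.
Proof.
have f_rel t : gpar_rel alpha t -> tensor_lift f_linearl f_linearr t = 0.
  case=> g [h [m [hm ->]]].
  rewrite (linearB (tensor_lift f_linearl f_linearr)).
  by rewrite [X in X - _]f_gen [X in _ - X]f_gen F_act // subrr.
exists (quot_lift f_rel) => g m.
exact: etrans (quot_lift_pi f_rel _) (f_gen g m).
Qed.

End Lift.

Lemma gpar_universal :
  universal_global_action alpha (Theta alpha) (gpar_iota alpha).
Proof.
split=> [//||N beta phi beta_global phi_eqv]; first exact: gpar_iota_equivariant.
have betaT g x : pdom beta g x by rewrite beta_global.
have beta_linear g : linear (pact beta g) by move=> a x y; apply: pact_linear.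
have betaM g h x : pact beta g (pact beta h x) = pact beta (g * h)%g x.
  by apply: pactM; split; apply: betaT.
have F_linear g : linear (fun m => pact beta g (phi m)).
  by move=> a m m'; rewrite linearP beta_linear.
have [g h m hm|psi psiE] := gpar_lift F_linear.
  by rewrite (phi_eqv h).2 // betaM.
exists psi; split=> [g|m|psi' psi'_eqv psi'_iota].
- split=> [y _|t _]; first exact: betaT.
  apply: (gpar_ext (f1 := psi \o pact (Theta alpha) g)
                   (f2 := pact beta g \o psi)) => [a x y|a x y|h m].
  + exact: etrans (congr1 psi (Theta_linear g a x y)) (linearP psi _ _ _).
  + exact: etrans (congr1 (pact beta g) (linearP psi a x y)) (beta_linear _ _ _ _).
  + apply: etrans (congr1 psi (Theta_gpar g h m)) (etrans (psiE _ _) _).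
    exact: esym (etrans (congr1 (pact beta g) (psiE h m)) (betaM _ _ _)).
- exact: etrans (psiE 1%g m) (pact1 beta _).
- apply: gpar_ext => [||g m]; [exact: linearP | exact: linearP |].
  apply: etrans (esym (congr1 psi' (Theta_iota g m))) _.
  apply: etrans ((psi'_eqv g).2 _ _) _ => //.
  exact: etrans (congr1 (pact beta g) (psi'_iota m)) (esym (psiE g m)).
Qed.

End GparTensorTheory.

Section PartialRepresentation.
Context {K : comPzRingType} {G : groupType} {M : lmodType K}.
Variable pi : partial_rep G M.
Let alpha := induced_partial_action pi.

(** A partial representation, unlike a partial action, is defined on all of
    [M], and this is what lets the evaluation of [g (x) m] land back in [M]. *)
Lemma gpar_eval : exists p : {linear gpar_tensor alpha -> M},
  forall g m, p (gpar alpha g m) = pi g m.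
Proof.
apply: gpar_lift => [g|g h m /induced_domV hm]; first exact: linearP.
by rewrite -[in LHS]hm -prepMVr prepVK.
Qed.

Lemma gpar_globalization :
  is_globalization alpha (Theta alpha) (gpar_iota alpha).
Proof.
have [p pE] := gpar_eval.
have iotaK : cancel (gpar_iota alpha) p.
  by move=> m; apply: etrans (pE 1%g m) (prep1 pi m).
split=> [//|||g].
- by split; [exact: can_inj iotaK | exact: gpar_iota_equivariant].
- exact: gpar_span.
apply/seteqP; split=> [_ [m gm <-]|_ [[_ [m' _ <-] <-] [m _ mE]]].
  split; last by exists m.
  have [gx _ gxS] := pact_bij alpha g; have [x xg <-] := gxS _ gm.
  exists (gpar_iota alpha x); first by exists x.
  exact: esym ((gpar_iota_equivariant alpha g).2 x xg).
exists m => //.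
have <- : pi g m' = m.
  rewrite -(iotaK m) mE; apply: esym.
  exact: etrans (congr1 p (Theta_iota alpha g m')) (pE g m').
exact: prep_dom.
Qed.

End PartialRepresentation.

Theorem theorem2p33 (K : comPzRingType) (G : groupType) (M : lmodType K)
    (pi : partial_rep G M) :
  let alpha := induced_partial_action pi in
  [/\ forall (h g : G) (m : M),
        pact (Theta alpha) h (gpar alpha g m) = gpar alpha (h * g)%g m,
      forall m : M, gpar_iota alpha m = gpar alpha 1%g m &
      universal_globalization alpha (Theta alpha) (gpar_iota alpha)].
Proof.
move=> alpha; split; [exact: Theta_gpar | exact: gpar_iotaE |].
by split; [exact: gpar_universal | exact: gpar_globalization].
Qed.
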